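(* Let $(\mathcal C,\partial)$ be the chain complex defined below, supported on $\Gamma(m,n)$. Then for each $i$, $H_i(\mathcal C,\partial;\mathbb Z)$ is free abelian with a basis given by the homology classes of the rook placements in $\mathcal R(m,n)$ of rank $i$ all of whose rooks lie on shaded squares of row $1$ (each of which is a cycle). Furthermore $$\sum_{i\ge0}\dim H_i(\mathcal C,\partial;\mathbb Z)\,q^i=q^{n(n-1)}\binom{\lfloor m/2\rfloor}{n}_{q^2}.$$
   Context: The staircase board of length $m$ consists of squares $(i,j)$, $i,j\ge1$, $i+j\le m$ (row $i$ from the top, column $j$ from the left). The squares below $(i,j)$ are $(i',j)$ with $i'>i$; there are $m-i-j$. Square $(i,j)$ is shaded if $m-i-j$ is even. $\mathcal R(m,n)$ is the set of placements of $n$ rooks with no two in the same column. $\Gamma(m,n)$ is the poset on $\mathcal R(m,n)$ generated by covers $T\lessdot T'$ when $T'\in\mathcal R(m,n)$ arises from $T$ by moving one rook one square up or one square left; it is graded with rank of $T$ equal to the total number of squares below the rooks of $T$. The chain complex: $\mathcal C_i$ is free abelian with basis the rank-$i$ elements of $\Gamma(m,n)$; for $T$, let $r_1,\dots,r_s$ be the rooks of $T$ lying on unshaded squares, listed from left to right, let $T_{r}$ be the placement obtained by moving rook $r$ down one square, and set $\partial(T)=\sum_{i=1}^s(-1)^{i-1}T_{r_i}$ (extended linearly); $\partial^2=0$. The Gaussian binomial is $\binom{a}{b}_x=\frac{[a]_x!}{[b]_x![a-b]_x!}$ with $[m]_x=1+\dots+x^{m-1}$ (and $0$ if $b>a$),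 here with $x=q^2$. *)

(* Defs.v *)
From HB Require Import structures.
From mathcomp Require Import all_boot all_order all_algebra.
From mathcomp Require Import boolp classical_sets.
From mathcomp Require Import zify.

Set Implicit Arguments.
Unset Strict Implicit.
Unset Printing Implicit Defensive.

Import GRing.Theory.
Local Open Scope ring_scope.

(* Coordinates are 1-based, so every square has both coordinates in 'I_m.+1. *)
Definition on_board (m : nat) (s : 'I_m.+1 * 'I_m.+1) : bool :=
  [&& 0 < s.1, 0 < s.2 & s.1 + s.2 <= m]%N.

Definition square (m : nat) := {s : 'I_m.+1 * 'I_m.+1 | on_board s}.

Definition row_of (m : nat) (s : square m) : nat := (val s).1.
Definition col_of (m : nat) (s : square m) : nat := (val s).2.

Definition below (m : nat) (s : square m) : {set square m} :=
  [set s' | (col_of s' == col_of s) && (row_of s < row_of s')%N].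

Definition shaded (m : nat) (s : square m) : bool :=
  ~~ odd (m - row_of s - col_of s).

Definition is_placement (m n : nat) (T : {set square m}) : bool :=
  (#|T| == n) &&
  [forall s in T, forall s' in T, (col_of s == col_of s') ==> (s == s')].

Definition placement (m n : nat) := {T : {set square m} | is_placement n T}.

Definition placement_rank (m n : nat) (T : placement m n) : nat :=
  \sum_(s in val T) #|below s|.

(* T' arises from T by moving one rook one square up or one square left. *)
Definition gamma_cover (m n : nat) (T T' : placement m n) : bool :=
  [exists s in val T, exists s' : square m,
     [|| (col_of s' == col_of s) && ((row_of s').+1 == row_of s)
       | (row_of s' == row_of s) && ((col_of s').+1 == col_of s)]
     && (val T' == s' |: (val T :\ s))].

Definition gamma_le (m n : nat) : rel (placement m n) :=
  connect (@gamma_cover m n).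

(* The default s is returned only when there is no square below s. *)
Definition square_down (m : nat) (s : square m) : square m :=
  insubd s (inord (row_of s).+1, (val s).2).

(* The default T is never used for a rook r of T on an unshaded square:
   see [val_move_down]. *)
Definition move_down (m n : nat) (T : placement m n) (r : square m) :
    placement m n :=
  insubd T (square_down r |: (val T :\ r)).

Definition unshaded_rooks (m n : nat) (T : placement m n) : {set square m} :=
  [set s in val T | ~~ shaded s].

(* Rooks lie in distinct columns, so this is i - 1 when r is the i-th unshaded
   rook from the left. *)
Definition rooks_left (m n : nat) (T : placement m n) (r : square m) : nat :=
  #|[set r' in unshaded_rooks T | (col_of r' < col_of r)%N]|.

(* The direct sum of the groups C_i. *)
Definition chain (m n : nat) := {ffun placement m n -> int}.

HB.instance Definition _ m n := GRing.Zmodule.on (chain m n).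

Definition gen (m n : nat) (T : placement m n) : chain m n :=
  [ffun T' => (T' == T)%:R].

Definition boundary_gen (m n : nat) (T : placement m n) : chain m n :=
  \sum_(r in unshaded_rooks T) gen (move_down T r) *~ (-1) ^+ rooks_left T r.

Definition boundary (m n : nat) (c : chain m n) : chain m n :=
  \sum_(T : placement m n) boundary_gen T *~ c T.

(* Membership in the summand C_i. *)
Definition in_degree (m n i : nat) (c : chain m n) : bool :=
  [forall T, (c T != 0) ==> (placement_rank T == i)].

Definition cycles (m n i : nat) : {pred chain m n} :=
  [pred c | in_degree i c && (boundary c == 0)].

Definition boundaries (m n i : nat) : {pred chain m n} :=
  [pred c | `[< exists2 d : chain m n, in_degree i.+1 d & c = boundary d >]].

Arguments cycles : clear implicits.
Arguments boundaries : clear implicits.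

Lemma in_degree0 m n i : in_degree i (0 : chain m n).
Proof. by apply/forallP => T; rewrite ffunE eqxx. Qed.

Lemma in_degreeB m n i (c d : chain m n) :
  in_degree i c -> in_degree i d -> in_degree i (c - d).
Proof.
move=> /forallP hc /forallP hd; apply/forallP => T; apply/implyP => h.
apply: contraNT h => hT; rewrite !ffunE.
have /eqP -> : c T == 0 by apply: contraNT hT; apply/implyP.
have /eqP -> : d T == 0 by apply: contraNT hT; apply/implyP.
by rewrite subrr.
Qed.

Lemma boundary_is_zmod_morphism m n : zmod_morphism (@boundary m n).
Proof.
move=> c d; rewrite /boundary -sumrB; apply: eq_bigr => T _.
by rewrite !ffunE mulrzBr.
Qed.

HB.instance Definition _ m n :=
  GRing.isZmodMorphism.Build (chain m n) (chain m n) (@boundary m n)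
    (@boundary_is_zmod_morphism m n).

Lemma squareP m (s : square m) :
  [/\ (0 < row_of s)%N, (0 < col_of s)%N & (row_of s + col_of s <= m)%N].
Proof. by case: s => s /=; rewrite /row_of /col_of /= => /and3P. Qed.

Lemma square_inj m (s s' : square m) :
  row_of s = row_of s' -> col_of s = col_of s' -> s = s'.
Proof.
case: s s' => [[a b] h] [[a' b'] h']; rewrite /row_of /col_of /= => e e'.
by apply: val_inj; congr pair; apply: val_inj.
Qed.

Lemma mk_square m i j : (0 < i)%N -> (0 < j)%N -> (i + j <= m)%N ->
  {s : square m | row_of s = i & col_of s = j}.
Proof.
move=> hi hj hij.
have li : (i < m.+1)%N by lia.
have lj : (j < m.+1)%N by lia.
have h : on_board (Ordinal li, Ordinal lj) by rewrite /on_board /= hi hj hij.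
by exists (Sub _ h : square m).
Qed.

Lemma card_below m (s : square m) : #|below s| = (m - row_of s - col_of s)%N.
Proof.
have [h1 h2 h3] := squareP s.
have mk (k : 'I_(m - row_of s - col_of s)) :
    {s' : square m | row_of s' = (row_of s + k).+1 & col_of s' = col_of s}.
  by apply: mk_square => //; have := ltn_ord k; lia.
pose f k := s2val (mk k).
have fr k : row_of (f k) = (row_of s + k).+1 by rewrite /f; case: (mk k).
have fc k : col_of (f k) = col_of s by rewrite /f; case: (mk k).
have fi : injective f.
  by move=> k l /(congr1 (@row_of m)); rewrite !fr => e; apply: val_inj => /=; lia.
rewrite -[RHS]card_ord -(card_imset _ fi); apply: eq_card => s'.
rewrite inE; apply/andP/imsetP => [[/eqP hc hr]|[k _ ->]].
  have [g1 g2 g3] := squareP s'.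
  have lk : (row_of s' - row_of s - 1 < m - row_of s - col_of s)%N by lia.
  exists (Ordinal lk) => //; apply: square_inj; rewrite ?fr ?fc //=; lia.
by rewrite fc fr eqxx; split=> //; lia.
Qed.

Lemma down_unshaded m (r : square m) : ~~ shaded r ->
  row_of (square_down r) = (row_of r).+1 /\ col_of (square_down r) = col_of r.
Proof.
rewrite /shaded negbK => hr; have [h1 h2 h3] := squareP r.
have h : (0 < m - row_of r - col_of r)%N by move: hr; case: (m - _ - _)%N.
have hi : (inord (row_of r).+1 : 'I_m.+1) = (row_of r).+1 :> nat by rewrite inordK //; lia.
have hb : on_board (inord (row_of r).+1 : 'I_m.+1, (val r).2).
  rewrite /on_board /= hi.
  have -> /= : (0 < (val r).2)%N by exact: h2.
  by apply/idP; change ((row_of r).+1 + col_of r <= m)%N; move: h h3; rewrite /col_of; lia.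
have e : val (square_down r) = (inord (row_of r).+1, (val r).2).
  by rewrite val_insubd hb.
by rewrite {1}/row_of {1}/col_of e /= hi.
Qed.

Lemma placement_col m n (T : placement m n) s s' : s \in val T -> s' \in val T ->
  col_of s = col_of s' -> s = s'.
Proof.
case: T => T /= /andP[_ /forall_inP h] hs hs' e.
by have /forall_inP/(_ _ hs')/implyP := h _ hs; rewrite e eqxx => /(_ isT)/eqP.
Qed.

Lemma card_placement m n (T : placement m n) : #|val T| = n.
Proof. by case: T => T /= /andP[/eqP]. Qed.

Lemma val_move_down m n (T : placement m n) (r : square m) :
  r \in unshaded_rooks T -> val (move_down T r) = square_down r |: (val T :\ r).
Proof.
rewrite inE => /andP[rT ur]; rewrite /move_down val_insubd.
have [dr dc] := down_unshaded ur.
have dN s : s \in val T -> s != r -> col_of s != col_of r.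
  by move=> sT; apply: contraNneq => e; apply/eqP; exact: placement_col sT rT e.
case: ifP => // /negP[]; apply/andP; split.
  have dT : square_down r \notin val T :\ r.
    rewrite !inE; apply/negP => /andP[h1 h2].
    by have := dN _ h2 h1; rewrite dc eqxx.
  rewrite cardsU1 dT; have := cardsD1 r (val T); rewrite rT.
  by rewrite card_placement => <-.
apply/forall_inP => s hs; apply/forall_inP => s' hs'; apply/implyP => /eqP e.
move: hs hs'; rewrite !inE.
case/predU1P => [es|/andP[h1 h2]]; case/predU1P => [es'|/andP[h3 h4]].
- by rewrite es es'.
- by have := dN _ h4 h3; rewrite -e es dc eqxx.
- by have := dN _ h2 h1; rewrite e es' dc eqxx.
- apply/eqP; exact: placement_col h2 h4 e.
Qed.

Lemma shaded_down m (r : square m) : ~~ shaded r -> shaded (square_down r).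
Proof.
move=> ur; have [dr dc] := down_unshaded ur.
have [] := squareP (square_down r); move: ur; rewrite /shaded negbK dr dc => o _ _ l.
have -> : (m - (row_of r).+1 - col_of r = (m - row_of r - col_of r).-1)%N by lia.
by case: (m - _ - _)%N o => //=.
Qed.

Lemma unshaded_move m n (T : placement m n) r : r \in unshaded_rooks T ->
  unshaded_rooks (move_down T r) = unshaded_rooks T :\ r.
Proof.
move=> h; apply/setP => s; rewrite !inE val_move_down // !inE.
have ur : ~~ shaded r by move: h; rewrite inE => /andP[].
case: (eqVneq s (square_down r)) => [->|_] //=; last by rewrite andbA.
by rewrite shaded_down //= !andbF.
Qed.

Lemma move_down_cover m n (T : placement m n) r : r \in unshaded_rooks T ->
  gamma_cover (move_down T r) T.
Proof.
move=> h; have := h; rewrite inE => /andP[rT ur].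
have [dr dc] := down_unshaded ur.
have dT : square_down r \notin val T :\ r.
  rewrite !inE; apply/negP => /andP[/eqP h1 h2]; case: h1.
  exact: placement_col h2 rT dc.
apply/exists_inP; exists (square_down r); first by rewrite val_move_down // setU11.
apply/existsP; exists r; rewrite dr dc !eqxx /= val_move_down //.
by rewrite finset.setU1K // finset.setD1K.
Qed.

Lemma gamma_cover_rank m n (T T' : placement m n) :
  gamma_cover T T' -> placement_rank T' = (placement_rank T).+1.
Proof.
case/exists_inP => s sT /existsP[s' /andP[hs /eqP e]].
have s'N : s' \notin val T :\ s.
  apply/negP => h; have := card_placement T'; rewrite e cardsU1 h.
  by have := cardsD1 s (val T); rewrite sT card_placement; lia.
rewrite /placement_rank e big_setU1 //= [in RHS](big_setD1 s) //= !card_below.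
have [h1 h2 h3] := squareP s'; have [g1 g2 g3] := squareP s.
by case/orP: hs => /andP[/eqP e1 /eqP e2]; lia.
Qed.

Lemma move_down_rank m n (T : placement m n) r : r \in unshaded_rooks T ->
  placement_rank T = (placement_rank (move_down T r)).+1.
Proof. by move/move_down_cover/gamma_cover_rank. Qed.

Lemma boundary_genE m n (T : placement m n) : boundary (gen T) = boundary_gen T.
Proof.
rewrite /boundary (bigD1 T) //= ffunE eqxx big1 ?addr0 // => T' h.
by rewrite ffunE (negPf h).
Qed.

Lemma rooks_left_move m n (T : placement m n) r s :
  r \in unshaded_rooks T -> s \in unshaded_rooks T -> s != r ->
  (rooks_left T s = (col_of r < col_of s) + rooks_left (move_down T r) s)%N.
Proof.
move=> hr hs nsr; rewrite /rooks_left (cardsD1 r) !inE.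
have -> : r \in val T by move: hr; rewrite inE => /andP[].
have -> : ~~ shaded r by move: hr; rewrite inE => /andP[].
congr addn; apply: eq_card => x; rewrite unshaded_move // !inE.
by rewrite andbA.
Qed.

Lemma boundary_boundary m n (c : chain m n) : boundary (boundary c) = 0.
Proof.
rewrite {2}/boundary raddf_sum big1 // => T _ /=.
rewrite raddfMz /=; have -> : boundary (boundary_gen T) = 0; last by rewrite mul0rz.
rewrite /boundary_gen raddf_sum /=.
pose U := unshaded_rooks T.
pose F r s := gen (move_down (move_down T r) s) *~
  ((-1) ^+ rooks_left (move_down T r) s * (-1) ^+ rooks_left T r).
have -> : \sum_(r in U) boundary (gen (move_down T r) *~ (-1) ^+ rooks_left T r)
  = \sum_(r in U) \sum_(s in U | s != r) F r s.
  apply: eq_bigr => r hr; rewrite raddfMz /= boundary_genE /boundary_gen.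
  rewrite mulrz_suml (unshaded_move hr).
  rewrite (eq_bigl (fun s => (s \in U) && (s != r))); last first.
    by move=> s; rewrite in_setD1 andbC.
  by apply: eq_bigr => s _; rewrite -mulrzA.
have anti r s : r \in U -> s \in U -> s != r -> F r s = - F s r.
  move=> hr hs nsr; rewrite /F.
  have -> : move_down (move_down T r) s = move_down (move_down T s) r.
    have hs' : s \in unshaded_rooks (move_down T r) by rewrite unshaded_move // !inE nsr; move: hs; rewrite inE.
    have hr' : r \in unshaded_rooks (move_down T s) by rewrite unshaded_move // !inE eq_sym nsr; move: hr; rewrite inE.
    have ur : ~~ shaded r by move: hr; rewrite inE => /andP[].
    have us : ~~ shaded s by move: hs; rewrite inE => /andP[].
    have n1 : s != square_down r by apply: contraNneq us => ->; apply: shaded_down.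
    have n2 : r != square_down s by apply: contraNneq ur => ->; apply: shaded_down.
    apply: val_inj; rewrite !val_move_down //; apply/setP => x; rewrite !inE.
    case: (eqVneq x s) => [->|_]; first by rewrite (negPf n1) nsr.
    case: (eqVneq x r) => [->|_]; first by rewrite (negPf n2) /= ?andbF ?orbF ?eqxx.
    by rewrite /= orbCA.
  rewrite -mulrNz; congr (_ *~ _).
  rewrite (rooks_left_move hr hs nsr) (rooks_left_move hs hr) 1?eq_sym //.
  have nc : col_of r != col_of s.
    apply: contraNneq nsr => e; apply/eqP.
    move: hr hs; rewrite !inE => /andP[h1 _] /andP[h2 _].
    exact: placement_col h2 h1 (esym e).
  by case: (ltngtP (col_of r) (col_of s)) nc => // _ _;
    rewrite /= ?add0n ?add1n ?exprS ?mulN1r ?mulrN ?mulNr ?opprK mulrC.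
have E : \sum_(r in U) \sum_(s in U | s != r) F r s
       = - \sum_(r in U) \sum_(s in U | s != r) F r s.
  rewrite {1}(exchange_big_dep (mem U)) //=; last by move=> r s _ /andP[].
  rewrite -sumrN; apply: eq_bigr => s hs; rewrite -sumrN.
  rewrite (eq_bigl (fun r => (r \in U) && (r != s))); last first.
    by move=> r; rewrite hs /= eq_sym.
  by apply: eq_bigr => r /andP[hr nrs]; rewrite anti // eq_sym.
move: (\sum_(r in U) _) E => S E.
apply/ffunP => x; have := congr1 (fun f : chain m n => f x) E.
have neg0 (a : int) : a = - a -> a = 0 by lia.
by rewrite /= !ffunE => /neg0.
Qed.

Lemma boundary_gen_in_degree m n (T : placement m n) i :
  placement_rank T = i.+1 -> in_degree i (boundary_gen T).
Proof.
move=> rT; apply/forallP => T'; apply/implyP; apply: contraR => nr.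
rewrite /boundary_gen sum_ffunE big1 // => r hr.
rewrite ffunMzE !ffunE (_ : T' == _ = false) ?mul0rz //.
apply: contraNF nr => /eqP ->.
by have := move_down_rank hr; rewrite rT => -[->].
Qed.

Lemma boundary_in_degree m n i (c : chain m n) :
  in_degree i.+1 c -> in_degree i (boundary c).
Proof.
move=> /forallP hc; rewrite /boundary.
elim/big_ind: _ => [|x y hx hy|T _]; first exact: in_degree0.
  rewrite -[y]opprK in_degreeB // -sub0r in_degreeB //; exact: in_degree0.
have [->|nz] := eqVneq (c T) 0; first by rewrite mulr0z in_degree0.
have rT : placement_rank T = i.+1 by apply/eqP; exact: implyP (hc T) nz.
have /forallP hg := boundary_gen_in_degree rT.
apply/forallP => T'; apply/implyP => h; apply: (implyP (hg T')).
by apply: contraNneq h => h0; rewrite ffunMzE h0 mul0rz.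
Qed.

Lemma boundary_degree0 m n (c : chain m n) : in_degree 0 c -> boundary c = 0.
Proof.
move=> /forallP hc; rewrite /boundary big1 // => T _.
have [->|nz] := eqVneq (c T) 0; first by rewrite mulr0z.
rewrite /boundary_gen big1 ?mul0rz // => r /move_down_rank.
by have /eqP -> := implyP (hc T) nz.
Qed.

Lemma cycles_zmod_closed m n i : zmod_closed (cycles m n i).
Proof.
split=> [|c d]; first by rewrite inE in_degree0 raddf0 eqxx.
rewrite !inE => /andP[hc /eqP zc] /andP[hd /eqP zd].
by rewrite in_degreeB //= raddfB /= zc zd subrr.
Qed.

HB.instance Definition _ m n i :=
  GRing.isZmodClosed.Build (chain m n) (cycles m n i)
    (@cycles_zmod_closed m n i).

Definition cycle_group (m n i : nat) := {c : chain m n | c \in cycles m n i}.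

HB.instance Definition _ m n i := SubChoice.on (cycle_group m n i).

HB.instance Definition _ m n i :=
  [SubChoice_isSubZmodule of cycle_group m n i by <:].

Definition boundary_pred (m n i : nat) : {pred cycle_group m n i} :=
  [pred z | val z \in boundaries m n i].

Arguments boundary_pred : clear implicits.

Lemma boundary_pred_zmod_closed m n i : zmod_closed (boundary_pred m n i).
Proof.
have mem z : reflect (exists2 d : chain m n, in_degree i.+1 d & val z = boundary d)
    (z \in boundary_pred m n i) by exact: asboolP.
split=> [|y z /mem[c hc ec] /mem[d hd ed]]; apply/mem.
  by exists 0; rewrite ?in_degree0 // !raddf0.
by exists (c - d); rewrite ?in_degreeB // !raddfB /= ec ed.
Qed.

HB.instance Definition _ m n i :=
  GRing.isZmodClosed.Build (cycle_group m n i) (boundary_pred m n i)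
    (@boundary_pred_zmod_closed m n i).

Definition homology (m n i : nat) : zmodType :=
  Quotient.quot (boundary_pred m n i).

Definition homology_class (m n i : nat) (c : chain m n)
    (hc : c \in cycles m n i) : homology m n i :=
  (\pi_(Quotient.quot (boundary_pred m n i))%qT (Sub c hc)).

(* Unique expansion over b: V is free abelian with basis the family b. *)
Definition zbasis (V : zmodType) (I : finType) (b : I -> V) : Prop :=
  forall v : V, exists! a : {ffun I -> int}, v = \sum_(i : I) b i *~ a i.

(* The rank of a free abelian group of finite rank; 0 on other groups. *)
Definition zrank (V : zmodType) : nat :=
  xget 0%N (fun d : nat => exists b : 'I_d -> V, zbasis b).

Definition shaded_first_row (m n i : nat) :=
  {T : placement m n |
    (placement_rank T == i) && [forall s in val T, shaded s && (row_of s == 1%N)]}.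

Definition qint (F : fieldType) (x : F) (k : nat) : F := \sum_(j < k) x ^+ j.

Definition qfact (F : fieldType) (x : F) (k : nat) : F :=
  \prod_(j < k) qint x j.+1.

Definition gauss_binomial (F : fieldType) (x : F) (a b : nat) : F :=
  if (a < b)%N then 0 else qfact x a / (qfact x b * qfact x (a - b)).

(* The indeterminate of the field of rational functions in which the
   generating-function identity is written. *)
Definition qvar : {fraction {poly int}} := tofrac 'X.

(* Main.v *)
(* Call a rook critical if it is on a shaded square of row 1. In a placement
   that is not all critical, toggle the leftmost noncritical rook, the pivot:
   down one square if it is unshaded, up one square if it is shaded. The upward half of
   this involution is a contracting homotopy h with dh + hd = 1 - p, where p is
   the projection onto the span of the critical placements; the signs cause no
   trouble because every rook left of the toggled one is shaded. Since a rook
   that has just moved down is never in row 1, p d = 0. Hence every cycle z is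
   homologous to p z and the classes of the critical placements are independent.

   A critical rook has an even number 2k of squares below it, and each
   k < floor(m/2) occurs in exactly one column, so the Poincare polynomial is the
   sum of q^(2 (k_1 + ... + k_n)) over the n-subsets of {0, ..., floor(m/2)-1},
   which the q-binomial theorem evaluates. *)

From HB Require Import structures.
Require Import Defs.
From mathcomp Require Import all_boot all_order all_algebra.
From mathcomp Require Import boolp zify ring.
Import GRing.Theory.
Local Open Scope ring_scope.

Set Implicit Arguments.
Unset Strict Implicit.
Unset Printing Implicit Defensive.

(** * Critical squares and downward moves *)

Definition critical_square m (s : square m) := shaded s && (row_of s == 1%N).

Definition critical m n (T : placement m n) :=
  [forall s in val T, critical_square s].

Lemma square_down_inj m (r s : square m) : ~~ shaded r -> ~~ shaded s ->
  square_down r = square_down s -> r = s.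
Proof.
move=> /down_unshaded[hr hr'] /down_unshaded[hs hs'] e.
by apply: square_inj; [apply: succn_inj; rewrite -hr -hs e | rewrite -hr' -hs' e].
Qed.

(** A shaded noncritical square is not in row 1, so there is a square above it, and shading
    alternates along a column. *)
Lemma square_down_exists m (s : square m) : shaded s -> ~~ critical_square s ->
  exists2 u : square m, ~~ shaded u & square_down u = s.
Proof.
move=> ss; rewrite /critical_square ss /= => s1; have [h1 h2 h3] := squareP s.
have [u ur uc] : {u : square m | row_of u = (row_of s).-1 & col_of u = col_of s}.
  by apply: mk_square; lia.
have uu : ~~ shaded u.
  move: ss; rewrite /shaded ur uc negbK.
  by have -> : (m - (row_of s).-1 - col_of s = (m - row_of s - col_of s).+1)%N by lia.
have [dr dc] := down_unshaded uu.
by exists u => //; apply: square_inj; rewrite ?dr ?dc // ur; lia.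
Qed.

Lemma unshaded_noncritical m (s : square m) : ~~ shaded s -> ~~ critical_square s.
Proof. by rewrite /critical_square; case: shaded. Qed.

Lemma down_noncritical m (s : square m) : ~~ shaded s ->
  ~~ critical_square (square_down s).
Proof.
move=> us; have [dr _] := down_unshaded us; have [h _ _] := squareP s.
by rewrite /critical_square dr; case: row_of h => //= k _; rewrite andbF.
Qed.

(** * The pivot of a placement *)

Definition is_pivot m n (T : placement m n) (r : square m) :=
  [&& r \in val T, ~~ critical_square r &
   [forall s in val T, (col_of s < col_of r)%N ==> critical_square s]].

Lemma is_pivotP m n (T : placement m n) r :
  reflect [/\ r \in val T, ~~ critical_square r &
    forall s, s \in val T -> (col_of s < col_of r)%N -> critical_square s]
    (is_pivot T r).
Proof.
apply: (iffP and3P) => -[h1 h2 h3]; split=> //.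
  by move=> s hs; apply/implyP; exact: (forall_inP h3).
by apply/forall_inP => s hs; apply/implyP; exact: h3.
Qed.

Lemma is_pivot_uniq m n (T : placement m n) r s :
  is_pivot T r -> is_pivot T s -> r = s.
Proof.
move=> /is_pivotP[h1 h2 h3] /is_pivotP[g1 g2 g3].
case: (ltngtP (col_of r) (col_of s)) => h; last exact: placement_col h1 g1 h.
  by rewrite g3 in h2.
by rewrite h3 in g2.
Qed.

Lemma pivot_exists m n (T : placement m n) : ~~ critical T -> exists r, is_pivot T r.
Proof.
move/forall_inPn => /=-[r0 hr0 nr0].
pose P r := (r \in val T) && ~~ critical_square r.
have P0 : P r0 by rewrite /P hr0.
case: (arg_minnP (@col_of m) P0) => r /andP[h1 h2] h3.
exists r; apply/is_pivotP; split=> // s hs; rewrite ltnNge; apply: contraNT => ns.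
by apply: h3; rewrite /P hs.
Qed.

(** * Toggling the pivot *)

Definition replace m n (T : placement m n) (r s : square m) : placement m n :=
  insubd T (s |: (val T :\ r)).

(** Within the column of [r] no second rook can interfere, so [insubd] never returns its default. *)
Lemma val_replace m n (T : placement m n) r s : r \in val T -> col_of s = col_of r ->
  val (replace T r s) = s |: (val T :\ r).
Proof.
move=> rT e; rewrite /replace val_insubd.
have N x : x \in val T -> x != r -> col_of x != col_of s.
  by move=> hx; apply: contraNneq => ex; apply/eqP/(placement_col hx rT); rewrite ex.
case: ifP => // /negP[]; apply/andP; split.
  have sN : s \notin val T :\ r.
    by rewrite !inE; apply/negP => /andP[h1 h2]; have := N _ h2 h1; rewrite eqxx.
  by have := cardsD1 r (val T); rewrite rT card_placement cardsU1 sN => <-.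
apply/forall_inP => x hx; apply/forall_inP => y hy; apply/implyP => /eqP exy.
move: hx hy; rewrite !inE => /predU1P[ex|/andP[h1 h2]] /predU1P[ey|/andP[h3 h4]].
- by rewrite ex ey.
- by have := N _ h4 h3; rewrite -exy ex eqxx.
- by have := N _ h2 h1; rewrite exy ey eqxx.
- by apply/eqP; exact: placement_col h2 h4 exy.
Qed.

Lemma in_unshaded_rooks m n (T : placement m n) r :
  (r \in unshaded_rooks T) = (r \in val T) && ~~ shaded r.
Proof. by rewrite inE. Qed.

(** A rook arrives on a shaded square, so it cannot meet the other rook, which is unshaded. *)
Lemma move_downC m n (T : placement m n) r s :
  r \in unshaded_rooks T -> s \in unshaded_rooks T -> s != r ->
  move_down (move_down T r) s = move_down (move_down T s) r.
Proof.
move=> hr hs nsr; have nrs : r != s by rewrite eq_sym.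
have [ur us] : ~~ shaded r /\ ~~ shaded s.
  by move: hr hs; rewrite !in_unshaded_rooks => /andP[_ ->] /andP[_ ->].
have n1 : s != square_down r by apply: contraNneq us => ->; exact: shaded_down.
have n2 : r != square_down s by apply: contraNneq ur => ->; exact: shaded_down.
have hs' : s \in unshaded_rooks (move_down T r) by rewrite unshaded_move // in_setD1 nsr.
have hr' : r \in unshaded_rooks (move_down T s) by rewrite unshaded_move // in_setD1 nrs.
apply: val_inj; rewrite !val_move_down //; apply/setP => x; rewrite !inE.
case: (eqVneq x s) => [->|_]; first by rewrite (negPf n1) nsr.
case: (eqVneq x r) => [->|_]; first by rewrite (negPf n2) /= ?andbF ?orbF ?eqxx.
by rewrite /= orbCA.
Qed.

(** Rooks left of the pivot are critical, hence shaded; any other unshaded rook is therefore to its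
    right, where a move does not affect the pivot. *)
Lemma pivot_move_down m n (T : placement m n) u s : is_pivot T u ->
  s \in unshaded_rooks T -> s != u ->
  is_pivot (move_down T s) u /\ (col_of u < col_of s)%N.
Proof.
move=> /is_pivotP[h1 h2 h3] hs nsu.
have [sT us] := andP (etrans (esym (in_unshaded_rooks T s)) hs).
have [_ dc] := down_unshaded us.
have lt : (col_of u < col_of s)%N.
  have [lt|gt|e] := ltngtP (col_of u) (col_of s) => //.
    by have := unshaded_noncritical us; rewrite h3.
  by have := placement_col h1 sT e => e'; rewrite e' eqxx in nsu.
split=> //; apply/is_pivotP; rewrite val_move_down //; split=> //.
  by rewrite !inE h1 (eq_sym u s) nsu orbT.
move=> x; rewrite !inE => /predU1P[->|/andP[_ hx]]; last exact: h3.
by rewrite dc; lia.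
Qed.

Lemma pivot_square_down m n (T : placement m n) u : is_pivot T u -> ~~ shaded u ->
  is_pivot (move_down T u) (square_down u).
Proof.
move=> /is_pivotP[h1 h2 h3] us; have [_ dc] := down_unshaded us.
apply/is_pivotP; rewrite val_move_down ?in_unshaded_rooks ?h1 //.
split; [by rewrite setU11 | exact: down_noncritical |].
move=> x; rewrite dc !inE => /predU1P[->|/andP[_ hx]]; last exact: h3.
by rewrite dc ltnn.
Qed.

(* The condition on u says that the pivot of T is shaded and that u is the square
   above it. *)
Definition homotopy_gen m n (T : placement m n) : chain m n :=
  if [pick u | ~~ shaded u && is_pivot T (square_down u)] is Some u
  then gen (replace T (square_down u) u) else 0.

Lemma homotopy_gen_down m n (T : placement m n) u : is_pivot T u -> ~~ shaded u ->
  homotopy_gen (move_down T u) = gen T.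
Proof.
move=> pu us; have pd := pivot_square_down pu us; have [_ dc] := down_unshaded us.
have [uT _ _] := is_pivotP _ _ pu; have [dT _ _] := is_pivotP _ _ pd.
have hu : u \in unshaded_rooks T by rewrite in_unshaded_rooks uT.
rewrite /homotopy_gen; case: pickP => [v /andP[vs pv]|/(_ u)]; last by rewrite us pd.
have -> : v = u by apply: square_down_inj => //; exact: is_pivot_uniq pv pd.
congr gen; apply: val_inj; rewrite val_replace // val_move_down //.
have dN : square_down u \notin val T :\ u.
  rewrite !inE; apply/negP => /andP[/eqP h1 h2]; case: h1.
  exact: placement_col h2 uT dc.
by rewrite setU1K // setD1K.
Qed.

Lemma homotopy_gen_unshaded m n (T : placement m n) r : is_pivot T r -> ~~ shaded r ->
  homotopy_gen T = 0.
Proof.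
move=> pr rs; rewrite /homotopy_gen; case: pickP => // v /andP[vs pv].
by move: rs; rewrite (is_pivot_uniq pr pv) shaded_down.
Qed.

Lemma critical_no_pivot m n (T : placement m n) r : critical T -> ~~ is_pivot T r.
Proof.
by move=> /forall_inP cT; apply/negP => /is_pivotP[h1 h2 _]; rewrite cT in h2.
Qed.

Lemma homotopy_gen_critical m n (T : placement m n) : critical T -> homotopy_gen T = 0.
Proof.
move=> cT; rewrite /homotopy_gen; case: pickP => // v /andP[_].
by move/negPf: (critical_no_pivot (square_down v) cT) ->.
Qed.

(** A placement with shaded pivot is presented as the lower partner [move_down T' u], so that the
    homotopy is computed by [homotopy_gen_down] alone. *)
Variant pivot_spec m n (T : placement m n) : Prop :=
| PivotNone of critical T
| PivotUnshaded u of is_pivot T u & ~~ shaded u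
| PivotShaded T' u of is_pivot T' u & ~~ shaded u & T = move_down T' u.

Lemma pivot_case m n (T : placement m n) : pivot_spec T.
Proof.
have [|/pivot_exists[r pr]] := boolP (critical T); first exact: PivotNone.
have [sr|] := boolP (shaded r); last exact: PivotUnshaded pr.
have [rT nr mr] := is_pivotP _ _ pr.
have [u us du] := square_down_exists sr nr; have [_ dc] := down_unshaded us.
rewrite du in dc; have vT := val_replace rT (esym dc).
have uN : u \notin val T :\ r.
  rewrite !inE; apply/negP => /andP[/eqP h1 h2]; case: h1.
  exact: placement_col h2 rT (esym dc).
apply: (@PivotShaded _ _ _ (replace T r u) u) => //.
  apply/is_pivotP; rewrite vT setU11; split=> //; first exact: unshaded_noncritical.
  move=> x; rewrite -dc !inE => /predU1P[->|/andP[_ hx]]; last exact: mr.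
  by rewrite dc ltnn.
apply: val_inj; rewrite val_move_down ?in_unshaded_rooks vT ?setU11 //.
by rewrite setU1K // du setD1K.
Qed.

(** This gives the toggled term the sign +1. *)
Lemma rooks_left_pivot m n (T : placement m n) r : is_pivot T r -> rooks_left T r = 0%N.
Proof.
move=> /is_pivotP[_ _ h]; apply/eqP; rewrite cards_eq0; apply/eqP/setP => s.
rewrite in_set in_unshaded_rooks in_set0; apply/negbTE/negP => /andP[/andP[sT us] lt].
by have := unshaded_noncritical us; rewrite h.
Qed.

(** * The homotopy identity *)

Definition homotopy m n (c : chain m n) : chain m n :=
  \sum_(T : placement m n) homotopy_gen T *~ c T.

Lemma homotopy_is_zmod_morphism m n : zmod_morphism (@homotopy m n).
Proof.
move=> c d; rewrite /homotopy -sumrB; apply: eq_bigr => T _.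
by rewrite !ffunE mulrzBr.
Qed.

HB.instance Definition _ m n :=
  GRing.isZmodMorphism.Build (chain m n) (chain m n) (@homotopy m n)
    (@homotopy_is_zmod_morphism m n).

Lemma homotopy_genE m n (T : placement m n) : homotopy (gen T) = homotopy_gen T.
Proof.
rewrite /homotopy (bigD1 T) //= ffunE eqxx big1 ?addr0 // => T' h.
by rewrite ffunE (negPf h).
Qed.

Lemma homotopy_boundary_gen m n (T : placement m n) :
  homotopy (boundary_gen T) = \sum_(r in unshaded_rooks T)
     homotopy_gen (move_down T r) *~ (-1) ^+ rooks_left T r.
Proof.
rewrite /boundary_gen raddf_sum; apply: eq_bigr => r _.
by rewrite raddfMz /= homotopy_genE.
Qed.

Lemma boundary_gen_critical m n (T : placement m n) : critical T -> boundary_gen T = 0.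
Proof.
move=> /forall_inP cT; rewrite /boundary_gen big1 // => r.
rewrite in_unshaded_rooks => /andP[/cT h /unshaded_noncritical].
by rewrite h.
Qed.

Lemma homotopyP_gen m n (T : placement m n) :
  boundary (homotopy_gen T) + homotopy (boundary_gen T)
  = if critical T then 0 else gen T.
Proof.
have ncrit (T1 : placement m n) r : is_pivot T1 r -> critical T1 = false.
  by move=> pr; apply/negP => /critical_no_pivot-/(_ r); rewrite pr.
case: (pivot_case T) => [cT|u pu us|T' u pu us ->].
- by rewrite cT homotopy_gen_critical // boundary_gen_critical // !raddf0 addr0.
- have hu : u \in unshaded_rooks T.
    by rewrite in_unshaded_rooks us andbT; case/is_pivotP: pu.
  rewrite (ncrit _ _ pu) (homotopy_gen_unshaded pu us) raddf0 add0r.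
  (* Only the term of [u] survives: after any other move [u] is still an unshaded pivot, which the
     homotopy sends to 0. *)
  rewrite homotopy_boundary_gen (bigD1 u) //= rooks_left_pivot // homotopy_gen_down //.
  rewrite big1 ?addr0 // => s /andP[hs nsu].
  have [ps _] := pivot_move_down pu hs nsu.
  by rewrite (homotopy_gen_unshaded ps us) mul0rz.
- have hu : u \in unshaded_rooks T'.
    by rewrite in_unshaded_rooks us andbT; case/is_pivotP: pu.
  rewrite (ncrit _ _ (pivot_square_down pu us)) homotopy_gen_down // boundary_genE.
  (* The [u]-term of the boundary of [T'] is the wanted generator; the remaining terms have to
     cancel against the homotopy of the boundary. *)
  rewrite homotopy_boundary_gen {1}/boundary_gen (bigD1 u) //= rooks_left_pivot //.
  rewrite -addrA (unshaded_move hu).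
  rewrite [X in _ + X](_ : _ = 0) ?addr0 //; apply/eqP; rewrite addr_eq0; apply/eqP.
  rewrite -sumrN; apply: eq_big => [s|s /andP[hs nsu]]; first by rewrite in_setD1 andbC.
  have [ps lt] := pivot_move_down pu hs nsu.
  (* Once [u] has moved down, [s] has one unshaded rook fewer on its left, so the two signs are
     opposite. *)
  rewrite move_downC // homotopy_gen_down // (rooks_left_move hu hs nsu) lt.
  by rewrite exprS mulN1r mulrNz.
Qed.

Lemma chainMzE m n (c : chain m n) (z : int) T : (c *~ z) T = c T *~ z.
Proof. exact: ffunMzE. Qed.

Lemma gen_eval m n (T T' : placement m n) : gen T T' = (T' == T)%:R.
Proof. by rewrite ffunE. Qed.

Lemma chain_sum m n (c : chain m n) : c = \sum_(T : placement m n) gen T *~ c T.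
Proof.
apply/ffunP => T; rewrite sum_ffunE.
under eq_bigr do rewrite chainMzE gen_eval.
rewrite [RHS](bigD1 T) //=.
 rewrite eqxx.
rewrite big1 ?addr0 => [|T' h].
 by rewrite intz.
by rewrite eq_sym (negPf h) mul0rz.
Qed.

Lemma homotopyP m n (c : chain m n) :
  boundary (homotopy c) + homotopy (boundary c)
  = c - \sum_(T : placement m n | critical T) gen T *~ c T.
Proof.
rewrite [X in X - _](chain_sum c) [X in X - _](bigID (@critical m n)) /= [RHS]addrAC subrr add0r.
rewrite [homotopy c]/homotopy [boundary c]/boundary !raddf_sum -big_split /= [RHS]big_mkcond.
apply: eq_bigr => T _; rewrite !raddfMz -mulrzDl homotopyP_gen.
by case: critical; rewrite ?mul0rz.
Qed.

(** Each placement occurring in a boundary has a rook that has just moved down, so outside row 1. *)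
Lemma boundary_critical m n (c : chain m n) (T : placement m n) :
  critical T -> boundary c T = 0.
Proof.
move=> cT; rewrite /boundary sum_ffunE big1 // => T' _.
rewrite chainMzE /boundary_gen sum_ffunE big1 ?mul0rz // => r hr.
rewrite chainMzE ffunE; case: eqP => [e|_]; last by rewrite mul0rz.
have us : ~~ shaded r by move: hr; rewrite in_unshaded_rooks => /andP[].
have /negP[] := down_noncritical us.
by apply: (forall_inP cT); rewrite e val_move_down // setU11.
Qed.

Lemma homotopy_gen_in_degree m n (T : placement m n) i :
  placement_rank T = i -> in_degree i.+1 (homotopy_gen T).
Proof.
case: (pivot_case T) => [cT|u pu us|T' u pu us ->] rT.
- by rewrite homotopy_gen_critical // in_degree0.
- by rewrite (homotopy_gen_unshaded pu us) in_degree0.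
- rewrite homotopy_gen_down //.
  have hu : u \in unshaded_rooks T'.
    by rewrite in_unshaded_rooks us andbT; case/is_pivotP: pu.
  apply/forallP => T1; rewrite gen_eval.
  by case: (eqVneq T1 T') => [->|_]; rewrite ?(move_down_rank hu) ?rT !eqxx.
Qed.

Lemma in_degreeD m n i (c d : chain m n) :
  in_degree i c -> in_degree i d -> in_degree i (c + d).
Proof.
by move=> hc hd; rewrite -[d]opprK in_degreeB // -sub0r in_degreeB // in_degree0.
Qed.

Lemma in_degreeMz m n i (c : chain m n) (z : int) : in_degree i c -> in_degree i (c *~ z).
Proof.
move=> /forallP hc; apply/forallP => T; apply/implyP => h; apply: (implyP (hc T)).
by apply: contraNneq h => h0; rewrite chainMzE h0 mul0rz.
Qed.

Lemma homotopy_in_degree m n i (c : chain m n) :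
  in_degree i c -> in_degree i.+1 (homotopy c).
Proof.
move=> /forallP hc; rewrite /homotopy.
elim/big_ind: _ => [|x y hx hy|T _]; [exact: in_degree0 | exact: in_degreeD |].
have [->|nz] := eqVneq (c T) 0; first by rewrite mulr0z in_degree0.
apply: in_degreeMz; apply: homotopy_gen_in_degree.
by apply/eqP; exact: implyP (hc T) nz.
Qed.

(** * The basis of homology *)

Lemma gen_cycle m n i (T : shaded_first_row m n i) : gen (val T) \in cycles m n i.
Proof.
have /andP[/eqP rT cT] := valP T.
rewrite inE boundary_genE boundary_gen_critical // eqxx andbT.
by apply/forallP => T'; rewrite gen_eval; case: (eqVneq T' (val T)) => [->|_]; rewrite ?rT !eqxx.
Qed.

Lemma homology_pi_eq m n i (y z : cycle_group m n i) :
  (\pi_(Quotient.quot (boundary_pred m n i))%qT y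
    = \pi_(Quotient.quot (boundary_pred m n i))%qT z) <->
  exists2 d : chain m n, in_degree i.+1 d & val y - val z = boundary d.
Proof.
split=> [/eqP|h].
  by rewrite -Quotient.idealrBE => /asboolP; rewrite raddfB.
by apply/eqP; rewrite -Quotient.idealrBE; apply/asboolP; rewrite raddfB.
Qed.

Lemma homology_class_basis m n i :
  zbasis (fun T : shaded_first_row m n i => homology_class (gen_cycle T)).
Proof.
pose S := shaded_first_row m n i.
have sumE (a : {ffun S -> int}) :
    \sum_(T : S) homology_class (gen_cycle T) *~ a T =
    \pi_(Quotient.quot (boundary_pred m n i))%qT
      (\sum_(T : S) (Sub (gen (val T)) (gen_cycle T) : cycle_group m n i) *~ a T).
  by rewrite raddf_sum; apply: eq_bigr => T _; rewrite raddfMz.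
have valE (a : {ffun S -> int}) :
    val (\sum_(T : S) (Sub (gen (val T)) (gen_cycle T) : cycle_group m n i) *~ a T)
    = \sum_(T : S) gen (val T) *~ a T.
  by rewrite raddf_sum; apply: eq_bigr => T _; rewrite raddfMz.
have coefE (a : {ffun S -> int}) (T : S) :
    (\sum_(T : S) gen (val T) *~ a T) (val T) = a T.
  rewrite sum_ffunE; under eq_bigr do rewrite chainMzE gen_eval.
  rewrite (bigD1 T) //= eqxx intz big1 ?addr0 // => T' h.
  case: (eqVneq (val T) (val T')) => [e|_]; last by rewrite mul0rz.
  by rewrite (val_inj e) eqxx in h.
move=> v; rewrite -[v]reprK; set z : cycle_group m n i := repr v.
(* The coordinates of a class are the values of a representing cycle at the critical placements; its
   homotopy bounds the difference. *)
exists [ffun T : S => val z (val T)]; split.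
  rewrite sumE; apply/homology_pi_eq; rewrite valE.
  have := valP z; rewrite inE => /andP[dz /eqP bz].
  exists (homotopy (val z)); first exact: homotopy_in_degree.
  have := homotopyP (val z); rewrite bz raddf0 addr0 => ->; congr (_ - _).
  (* [homotopyP] sums over critical placements of every rank; those of rank other than [i] have
     coefficient 0 in [z]. *)
  rewrite [RHS](bigID (fun T => placement_rank T == i)) /= [X in _ = _ + X]big1 ?addr0.
    rewrite [RHS](reindex_omap (val : S -> _) insub) /=; last first.
      by move=> T /andP[cT rT]; rewrite insubT //= rT.
    apply: eq_big => [T|T _]; last by rewrite ffunE.
    by have /andP[-> cT] := valP T; rewrite valK eqxx !andbT; symmetry.
  move=> T /andP[_ rT]; have /eqP -> : val z T == 0; last by rewrite mulr0z.
  by apply: contraNT rT => nz; exact: implyP (forallP dz T) nz.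
(* Uniqueness: evaluation at a critical placement kills boundaries, so it reads off the
   coefficient. *)
move=> a; rewrite sumE => /homology_pi_eq[d _]; rewrite valE => /= E.
apply/ffunP => T; rewrite ffunE; apply/eqP; rewrite -subr_eq0.
have /andP[_ cT] := valP T.
by have := boundary_critical d cT; rewrite -E !ffunE coefE => ->.
Qed.

(** * Invariance of rank *)

Lemma zbasis_card_le (V : zmodType) (I J : finType) (b : I -> V) (c : J -> V) :
  zbasis b -> zbasis c -> (#|I| <= #|J|)%N.
Proof.
move=> hb hc.
(* [A i] lists the coordinates of [b i] in [c], and [B j] those of [c j] in [b]; the [let] keeps the
   existence half of [exists!]. *)
have [A hA] := choice (fun i => let: ex_intro a (conj h _) := hc (b i) in ex_intro _ a h).
have [B hB] := choice (fun j => let: ex_intro a (conj h _) := hb (c j) in ex_intro _ a h).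
(* The product of the two transition matrices is the identity of size [#|I|], which bounds [#|I|] by
   the inner dimension [#|J|]. *)
apply: (@mulmx1_min int _ _ (\matrix_(i, j) A (enum_val i) (enum_val j))
  (\matrix_(j, i) B (enum_val j) (enum_val i))).
apply/matrixP => i k; rewrite !mxE.
have [a [ha ua]] := hb (b (enum_val i)).
(* Two expansions of the same basis element in [b]: the trivial one, and the one through [c] and
   back. *)
pose d1 := [ffun k' : I => (enum_val i == k')%:R : int].
pose d2 := [ffun k' : I => \sum_(j : J) A (enum_val i) j * B j k' : int].
have E1 : a = d1.
  apply: ua; rewrite (bigD1 (enum_val i)) //= ffunE eqxx mulr1z big1 ?addr0 // => k' h.
  by rewrite ffunE eq_sym (negPf h) mulr0z.
have E2 : a = d2.
  apply: ua; rewrite {1}hA.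
  under eq_bigr do rewrite hB mulrz_suml.
  rewrite exchange_big /=; apply: eq_bigr => k' _; rewrite ffunE.
  by rewrite mulrz_sumr; apply: eq_bigr => j _; rewrite -mulrzA mulrC.
have := congr1 (fun f : {ffun I -> int} => f (enum_val k)) (etrans (esym E2) E1).
rewrite !ffunE (inj_eq enum_val_inj) => <-.
rewrite [RHS](reindex_onto enum_val enum_rank) /=; last by move=> j _; rewrite enum_rankK.
by apply: eq_big => [j|j _]; rewrite ?enum_valK ?eqxx // !mxE.
Qed.

Lemma zbasis_zrank (V : zmodType) (I : finType) (b : I -> V) :
  zbasis b -> zrank V = #|I|.
Proof.
move=> hb; rewrite /zrank; apply: classical_sets.xget_unique.
  exists (b \o enum_val) => v; have [a [ha ua]] := hb v.
  exists [ffun i => a (enum_val i)]; split.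
    rewrite ha [LHS](reindex_onto enum_val enum_rank) /=.
      by apply: eq_big => [j|j _]; rewrite ?enum_valK ?eqxx // !ffunE.
    by move=> j _; rewrite enum_rankK.
  move=> a' ha'; have -> : a = [ffun x => a' (enum_rank x)].
    apply: ua; rewrite ha' [RHS](reindex_onto enum_val enum_rank) /=.
      by apply: eq_big => [j|j _]; rewrite ?enum_valK ?eqxx // !ffunE enum_valK.
    by move=> j _; rewrite enum_rankK.
  by apply/ffunP => j; rewrite !ffunE enum_valK.
move=> d [c hc]; apply/eqP; rewrite -[d]card_ord eqn_leq.
by rewrite (zbasis_card_le hb hc) (zbasis_card_le hc hb).
Qed.

(** * The q-binomial theorem *)

Section Gauss.
Variables (F : fieldType) (x : F).
Hypothesis qint_neq0 : forall k, qint x k.+1 != 0.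

Lemma qfact_neq0 k : qfact x k != 0.
Proof. by apply/prodf_neq0 => i _; exact: qint_neq0. Qed.

Lemma qfactS k : qfact x k.+1 = qfact x k * qint x k.+1.
Proof. exact: big_ord_recr. Qed.

Lemma qfact0 : qfact x 0 = 1.
Proof. exact: big_ord0. Qed.

Lemma qintD a b : qint x (a + b) = qint x a + x ^+ a * qint x b.
Proof.
rewrite /qint big_split_ord /= mulr_sumr; congr (_ + _).
by apply: eq_bigr => j _; rewrite exprD.
Qed.

Lemma gauss_binomial0 a : gauss_binomial x a 0 = 1.
Proof. by rewrite /gauss_binomial ltn0 subn0 qfact0 mul1r divff ?qfact_neq0. Qed.

Lemma gauss_binomial_small a b : (a < b)%N -> gauss_binomial x a b = 0.
Proof. by rewrite /gauss_binomial => ->. Qed.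

(** The q-Pascal rule, from splitting [[a+1]] as [[a-b] + x^(a-b) [b+1]] in the numerator. The case
    [a = b] is separate, since there one binomial is 0 by convention. *)
Lemma gauss_binomialS a b : (b <= a)%N ->
  gauss_binomial x a.+1 b.+1 = gauss_binomial x a b.+1 + x ^+ (a - b) * gauss_binomial x a b.
Proof.
move=> le; have [k ->] : exists k, a = (b + k)%N by exists (a - b)%N; lia.
rewrite /gauss_binomial !ltnS subSS addKn.
have -> : (b + k < b)%N = false by lia.
case: k => [|k].
  by rewrite addn0 leqnn add0r expr0 mul1r qfact0 !mulr1 !divff ?qfact_neq0.
have -> : (b + k.+1 <= b)%N = false by lia.
have -> : (b + k.+1 - b.+1 = k)%N by lia.
have := qintD k.+1 b.+1; rewrite addnC addSn => E.
rewrite (qfactS (b + _)) (qfactS b) (qfactS k) E.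
have := qfact_neq0 b; have := qfact_neq0 k.
have := qint_neq0 b; have := qint_neq0 k.
move: (qfact _ _) (qfact _ _) (qfact _ _) (qint _ _) (qint _ _) => f g h u v.
move=> *; field.
by apply/and4P; split.
Qed.

(** Induction on [M]: the last factor [1 + x^M X] reproduces the q-Pascal rule, because
    [M + C(n,2) = C(n+1,2) + (M-n)]. *)
Lemma qbinomial_theorem M n :
  (\prod_(k < M) (1 + x ^+ k *: 'X) : {poly F})`_n
  = x ^+ 'C(n, 2) * gauss_binomial x M n.
Proof.
elim: M n => [|M IH] n.
  rewrite big_ord0 coef1; case: n => [|n]; first by rewrite gauss_binomial0 mulr1.
  by rewrite gauss_binomial_small // mulr0.
rewrite big_ord_recr /= mulrDr mulr1 -scalerAr coefD coefZ coefMX IH.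
case: n => [|n] /=; first by rewrite !gauss_binomial0 mulr0 addr0.
rewrite IH; have [lt|le] := ltnP M n.
  by rewrite !gauss_binomial_small ?mulr0 ?addr0 // ltnW.
rewrite gauss_binomialS // mulrDr; congr (_ + _).
rewrite !mulrA -!exprD; congr (_ ^+ _ * _).
by rewrite binS bin1; lia.
Qed.

(** Expanding the product over subsets of factors, the coefficient of [X^n] collects the
    [n]-subsets. *)
Lemma sum_subsets_qbinomial M n :
  \sum_(A : {set 'I_M} | #|A| == n) x ^+ (\sum_(k in A) k)
  = x ^+ 'C(n, 2) * gauss_binomial x M n.
Proof.
rewrite -qbinomial_theorem.
under [in RHS]eq_bigr do rewrite addrC.
rewrite bigA_distr coef_sum [LHS]big_mkcond; apply: eq_bigr => A _.
rewrite -big_mkcond /= scaler_prod prodr_const coefZ coefXn prodrXr eq_sym.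
by case: eqP; rewrite ?mulr1 ?mulr0.
Qed.
End Gauss.

(** * The Poincaré polynomial *)

Lemma mk_critical_square m (k : 'I_m./2) :
  {s : square m | row_of s = 1%N & col_of s = (m - 1 - k.*2)%N}.
Proof. by apply: mk_square => //; have := ltn_ord k; lia. Qed.

(* The shaded square of row 1 with [k.*2] squares below it. *)
Definition first_row_square m (k : 'I_m./2) : square m := s2val (mk_critical_square k).

Lemma row_first_row_square m (k : 'I_m./2) : row_of (first_row_square k) = 1%N.
Proof. by rewrite /first_row_square; case: mk_critical_square. Qed.

Lemma col_first_row_square m (k : 'I_m./2) :
  col_of (first_row_square k) = (m - 1 - k.*2)%N.
Proof. by rewrite /first_row_square; case: mk_critical_square. Qed.

Lemma col_first_row_square_inj m :
  injective (fun k : 'I_m./2 => col_of (first_row_square k)).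
Proof.
move=> k l; rewrite !col_first_row_square => e; apply: val_inj => /=.
by have := ltn_ord k; have := ltn_ord l; lia.
Qed.

Lemma first_row_square_inj m : injective (@first_row_square m).
Proof. by move=> k l e; apply: col_first_row_square_inj; rewrite e. Qed.

Lemma critical_squareP m (s : square m) :
  reflect (exists k, s = first_row_square k) (critical_square s).
Proof.
have [h1 h2 h3] := squareP s.
apply: (iffP andP) => [[ss /eqP r1]|[k ->]]; last first.
  rewrite /shaded row_first_row_square col_first_row_square; split=> //.
  by have := ltn_ord k; lia.
have lk : ((m - 1 - col_of s)./2 < m./2)%N by lia.
exists (Ordinal lk); apply: square_inj.
  by rewrite row_first_row_square.
rewrite col_first_row_square /=.
by move: ss; rewrite /shaded r1; lia.
Qed.

Lemma sum_critical (R : comNzRingType) (q : R) m n :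
  \sum_(T : placement m n | critical T) q ^+ placement_rank T
  = \sum_(A : {set 'I_m./2} | #|A| == n) (q ^+ 2) ^+ (\sum_(k in A) k).
Proof.
pose crit (S : {set square m}) := [forall s in S, critical_square s].
pose rk (S : {set square m}) := (\sum_(s in S) #|below s|)%N.
(* Sums over plain sets can be reindexed by image and preimage under [f], which are mutually inverse
   on critical sets. *)
transitivity (\sum_(S : {set square m} | is_placement n S && crit S) q ^+ rk S).
  rewrite [RHS](reindex_omap (val : placement m n -> _) insub) /=; last first.
    by move=> S /andP[pS _]; rewrite insubT.
  by apply: eq_bigl => T; rewrite valK eqxx andbT (valP T).
pose f := @first_row_square m.
rewrite (reindex_onto (fun A : {set 'I_m./2} => f @: A) (fun S => f @^-1: S)) /=; last first.
  move=> S /andP[_ /forall_inP cS]; apply/setP => s; apply/imsetP/idP.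
    by case=> k; rewrite inE => ? ->.
  by move=> hs; have /critical_squareP[k e] := cS s hs; exists k => //; rewrite inE /f -e.
apply: eq_big => [A|A _].
  have -> : f @^-1: (f @: A) = A.
    by apply/setP => k; rewrite inE mem_imset //; exact: first_row_square_inj.
  rewrite eqxx andbT /is_placement card_imset; last exact: first_row_square_inj.
  rewrite -andbA; case: (#|A| == n) => //=; apply/andP; split; last first.
    by apply/forall_inP => _ /imsetP[k _ ->]; apply/critical_squareP; exists k.
  apply/forall_inP => _ /imsetP[k _ ->]; apply/forall_inP => _ /imsetP[l _ ->].
  by apply/implyP => /eqP/col_first_row_square_inj ->.
rewrite -exprM /rk big_imset /=; last by move=> k l _ _; exact: first_row_square_inj.
congr (_ ^+ _); rewrite big_distrr /=; apply: eq_bigr => k _.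
rewrite card_below row_first_row_square col_first_row_square.
by have := ltn_ord k; lia.
Qed.

Lemma placement_rank_le m n (T : placement m n) : (placement_rank T <= n * m)%N.
Proof.
rewrite /placement_rank -[in X in (_ <= X)%N](card_placement T) -sum_nat_const.
by apply: leq_sum => s _; rewrite card_below; lia.
Qed.

Lemma sum_card_critical (R : comNzRingType) (q : R) m n N : (n * m <= N)%N ->
  \sum_(i < N.+1) #|{: shaded_first_row m n i}|%:R * q ^+ i
  = \sum_(T : placement m n | critical T) q ^+ placement_rank T.
Proof.
move=> hN.
(* Ranks are at most [n * m <= N], so [inord] never returns its default. *)
have rE (T : placement m n) : inord (placement_rank T) = placement_rank T :> nat
    := inordK (leq_ltn_trans (placement_rank_le T) (hN : (n * m < N.+1)%N)).
rewrite (partition_big (fun T => inord (placement_rank T) : 'I_N.+1) xpredT) //=.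
apply: eq_bigr => i _; rewrite card_sig -sum1_card natr_sum mulr_suml.
apply: eq_big => [T|T]; first by rewrite -val_eqE /= rE andbC.
by move=> /andP[/eqP -> _]; rewrite mul1r.
Qed.

Lemma qint_qvar2_neq0 k : qint (qvar ^+ 2) k.+1 != 0.
Proof.
have -> : qint (qvar ^+ 2) k.+1 = tofrac (\sum_(j < k.+1) ('X^2 : {poly int}) ^+ j).
  by rewrite /qint rmorph_sum; apply: eq_bigr => j _; rewrite !rmorphXn.
(* The polynomial is nonzero because its value at 0 is 1. *)
rewrite tofrac_eq0; apply/eqP => /(congr1 (horner^~ 0)) /eqP.
rewrite horner0 horner_sum big_ord_recl big1 => [|j _].
  by rewrite expr0 hornerC addr0 oner_eq0.
by rewrite horner_exp hornerXn lift0 expr2 mul0r exprS mul0r.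
Qed.

Theorem theorem8p7 (m n : nat) :
  (forall i : nat,
     exists cyc : forall T : shaded_first_row m n i, gen (val T) \in cycles m n i,
       zbasis (fun T : shaded_first_row m n i => homology_class (cyc T)))
  /\
  (* H_i = 0 for i > n * m, so every such truncation is the whole series. *)
  (forall N : nat, (n * m <= N)%N ->
     \sum_(i < N.+1) (zrank (homology m n i))%:R * qvar ^+ i
     = qvar ^+ (n * (n - 1)) * gauss_binomial (qvar ^+ 2) m./2 n).
Proof.
split=> [i|N hN].
  by exists (@gen_cycle m n i); exact: homology_class_basis.
under eq_bigr do rewrite (zbasis_zrank (@homology_class_basis _ _ _)).
rewrite sum_card_critical // sum_critical sum_subsets_qbinomial; last first.
  exact: qint_qvar2_neq0.
rewrite -exprM; congr (_ ^+ _ * _).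
(* [bin2] expresses ['C(n, 2)] by a rounded half; evenness makes its double exactly
   [n * (n - 1)]. *)
have even : odd (n * n.-1) = false by case: (n) => [|k] //; rewrite oddM /= andNb.
by rewrite bin2 mul2n subn1 -[RHS]odd_double_half even.
Qed.
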